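(* Homogeneous polyhedra generated by Conway $(n,k)$-spirals are never mono-monostatic. That is, for every positive integer $n$, every integer $k>2$ and every Conway $(n,k)$-spiral $P_{n,k}\subset\mathbb{R}^3$, the convex polyhedron $P_{n,k}$ equipped with uniform mass density is not mono-monostatic.
   Context: Conway $n$-spiral: an open polygonal curve in the $[xz]$-plane of $\mathbb{R}^3$ with $n+1$ vertices $P_0,\dots,P_n$ such that, with $O$ the origin, $P_0=(0,0,1)$, $\angle O P_i P_{i-1}=\pi/2$ for $i=1,\dots,n$, and $P_1,\dots,P_n$ all have positive $x$-coordinate. The central angles are $\alpha_i=\angle P_iOP_{i-1}$ $(i=1,\dots,n)$, and $\alpha_{n+1}=\pi-\sum_{i=1}^n\alpha_i$. The rays $OP_0,OP_1,\dots,OP_n$ turn successively in the same direction away from the positive $z$-axis, so that $$P_i=\Big(\prod_{j=1}^i\cos\alpha_j\Big)\Big(\sin\sum_{j=1}^i\alpha_j,\;0,\;\cos\sum_{j=1}^i\alpha_j\Big),\qquad i=1,\dots,n,$$ with $0<\alpha_i<\pi/2$ for $i=1,\dots,n$ and $\sum_{j=1}^n\alpha_j<\pi$. Conway $(n,k)$-spiral $(k>2)$: take a Conway $n$-spiral and its rotated copies about the $z$-axis by the multiples of $2\pi/k$. Since $P_0$ lies on the $z$-axis, this gives $kn+1$ vertices. Together with the edges of the $k$ spirals one adds the edges of $n$ regular $k$-gons in planes parallel to the $[xy]$-plane (the $i$-th one formed by the $k$ rotated copies of $P_i$). This defines a convex polyhedron $P_{n,k}$ (the convex hull of these points) with $kn+1$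 vertices, $2nk$ edges and $kn+1$ faces. Homogeneous: the mass is distributed with uniform density in the polyhedron; $c$ denotes the resulting center of mass. Equilibria: for a $3$-dimensional convex polyhedron $P$ with center of mass $c\in\mathrm{int}\,P$, a point $q\in\mathrm{bd}\,P$ is an equilibrium point if the plane $H$ through $q$ perpendicular to $[c,q]$ supports $P$ at $q$. It is nondegenerate if $H\cap P$ is the unique vertex, edge or face of $P$ containing $q$ in its relative interior. A nondegenerate equilibrium point is stable, saddle-type or unstable if $\dim(H\cap P)=2,1,0$, respectively. $P$ is mono-monostatic if all its equilibrium points are nondegenerate and it has exactly one stable and exactly one unstable equilibrium point. *)

(* Defs.v *)
From HB Require Import structures.
From mathcomp Require Import all_boot all_order all_algebra.
From mathcomp Require Import all_classical all_reals all_analysis.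

Set Implicit Arguments.
Unset Strict Implicit.
Unset Printing Implicit Defensive.

Import Order.TTheory GRing.Theory Num.Theory.
Import numFieldNormedType.Exports.

Local Open Scope classical_set_scope.
Local Open Scope ring_scope.

Section EuclideanSpace.
Context {R : realType}.
Implicit Types (p q u v : 'rV[R]_3) (S F : set 'rV[R]_3).

Definition vec3 (x y z : R) : 'rV[R]_3 := \row_(i < 3) [:: x; y; z]`_i.

(* The norm of the library on 'rV[R]_3 is the maximum norm; it induces the
   usual topology, but lengths and angles need the Euclidean structure. *)
Definition dot u v : R := \sum_(i < 3) u 0 i * v 0 i.

Definition enorm u : R := Num.sqrt (dot u u).

(* Unoriented angle at the vertex q, in [0, pi]. *)
Definition angle p q v : R :=
  acos (dot (p - q) (v - q) / (enorm (p - q) * enorm (v - q))).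

Definition rotz (t : R) p : 'rV[R]_3 :=
  vec3 (cos t * p 0 0 - sin t * p 0 1) (sin t * p 0 0 + cos t * p 0 1) (p 0 2).

Definition convex_hull S : set 'rV[R]_3 :=
  smallest (fun C : set 'rV[R]_3 => @convex_set R 'rV[R]_3 C) S.

Definition affine_set S : Prop :=
  forall p q (t : R), S p -> S q -> S ((1 - t) *: p + t *: q).

Definition affine_hull S : set 'rV[R]_3 := smallest affine_set S.

Definition has_dim S (d : nat) : Prop :=
  exists p (V : {vspace 'rV[R]_3}),
    affine_hull S = [set p + v | v in [set` V]] /\ (\dim V)%VS = d.

Definition bd S : set 'rV[R]_3 := closure S `\` interior S.

(* Interior for the topology induced on the affine hull. *)
Definition relint S : set 'rV[R]_3 :=
  [set q | S q /\ within (affine_hull S) (nbhs q) S].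

Definition plane q u : set 'rV[R]_3 := [set p | dot (p - q) u = 0].

Definition supports S q u : Prop :=
  [/\ u != 0, S q &
      (forall p, S p -> dot (p - q) u <= 0) \/
      (forall p, S p -> 0 <= dot (p - q) u)].

(* Faces of dimension 0, 1 and 2 are the vertices, edges and faces of a
   polyhedron. *)
Definition face S (d : nat) F : Prop :=
  (exists q u, supports S q u /\ F = plane q u `&` S) /\ has_dim F d.

(* Lebesgue measure on R^3, carried by triples; [of_triple] is the identity
   R * R * R = 'rV[R]_3. *)
Definition leb3 : {measure set ((measurableTypeR R * measurableTypeR R) *
                                 measurableTypeR R) -> \bar R} :=
  ((@lebesgue_measure R \x @lebesgue_measure R) \x @lebesgue_measure R)%E.

Definition of_triple (p : (R * R) * R) : 'rV[R]_3 := vec3 p.1.1 p.1.2 p.2.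

Definition volume S : R := fine (leb3 (of_triple @^-1` S)).

Definition center_of_mass S : 'rV[R]_3 :=
  (volume S)^-1 *:
  \row_(i < 3) \int[leb3]_(p in of_triple @^-1` S) of_triple p 0 i.

End EuclideanSpace.

Section Equilibria.
Context {R : realType}.
Implicit Types (S : set 'rV[R]_3) (c q : 'rV[R]_3).

(* These notions are meant for c in the interior of S, which holds for the
   center of mass of a convex body; the definitions do not require it. *)

Definition contact S c q : set 'rV[R]_3 := plane q (q - c) `&` S.

Definition equilibrium S c q : Prop := bd S q /\ supports S q (q - c).

Definition nondegenerate S c q : Prop :=
  unique (fun F => (exists2 d, (d < 3)%N & face S d F) /\ relint F q)
         (contact S c q).

Definition stable S c q : Prop :=
  [/\ equilibrium S c q, nondegenerate S c q & has_dim (contact S c q) 2].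

Definition unstable S c q : Prop :=
  [/\ equilibrium S c q, nondegenerate S c q & has_dim (contact S c q) 0].

Definition mono_monostatic S c : Prop :=
  [/\ forall q, equilibrium S c q -> nondegenerate S c q,
      exists! q, stable S c q &
      exists! q, unstable S c q].

End Equilibria.

Section ConwaySpirals.
Context {R : realType}.
Implicit Types P : nat -> 'rV[R]_3.

(* Only the vertices P 0, ..., P n matter. The last condition says that the
   rays from the origin turn strictly away from the positive z-axis; it
   excludes P i.+1 = P i, for which [angle] has a junk value. *)
Definition conway_spiral (n : nat) P : Prop :=
  [/\ P 0%N = vec3 0 0 1,
      forall i, (i <= n)%N -> P i 0 1 = 0,
      forall i, (0 < i <= n)%N -> 0 < P i 0 0,
      forall i, (i < n)%N -> angle 0 (P i.+1) (P i) = pi / 2 &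
      forall i, (i < n)%N ->
        angle (vec3 0 0 1) 0 (P i) < angle (vec3 0 0 1) 0 (P i.+1)].

Definition conway_vertices (n k : nat) P : set 'rV[R]_3 :=
  [set p | exists i j, [/\ (i <= n)%N, (j < k)%N &
                           p = rotz (j%:R * (2 * pi / k%:R)) (P i)]].

Definition conway_polyhedron (n k : nat) P : set 'rV[R]_3 :=
  convex_hull (conway_vertices n k P).

End ConwaySpirals.

(* Main.v *)
(* The polyhedron has the k-fold symmetry of its vertex set, so its center of
   mass is c = (0, 0, h). Along a spiral the distance to O decreases, and every
   vertex P_m supports the profile: <P_i, P_m> <= |P_m|^2. Hence the horizontal
   slice at height s >= 0 contains the slice at height - s, and h >= 0. But
   <P_i - P_n, P_n - c> <= - h (z_i - z_n), so for h >= 0 each of the k copies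
   of P_n is an equilibrium; being a vertex, it is unstable if it is
   nondegenerate, and there are then at least two unstable points. *)
Require Import Defs.
From HB Require Import structures.
From mathcomp Require Import all_boot all_order all_algebra.
From mathcomp Require Import all_classical all_reals all_analysis.
From mathcomp Require Import measurable_realfun ring lra.

Set Implicit Arguments.
Unset Strict Implicit.
Unset Printing Implicit Defensive.

Import Order.TTheory GRing.Theory Num.Theory.
Import numFieldNormedType.Exports.

Local Open Scope classical_set_scope.
Local Open Scope ring_scope.

Section Coordinates.
Context {R : realType}.
Implicit Types (p q : 'rV[R]_3).

(** Every horizontal slice is a dilate of one regular k-gon around the axis, so comparing the slices
    at heights s and -s means comparing two radii of the planar profile. The radius r at height -s
    is controlled only through the supporting half-planes of the vertices. Let P_i P_{i+1} be the
    edge of the spiral at height s; by the right angle it lies on the line <X, P_{i+1}> =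
    |P_{i+1}|^2. If z_{i+1} <= 0, moving from height -s to s only relaxes the bound that P_{i+1}
    puts on the radius. If z_{i+1} > 0, the edge at height -s comes later on the spiral, hence is no
    farther from O, and since s and -s have the same square, distances compare radii. Only h >= 0
    results. For h = 0 the right angle at P_n puts the whole edge P_{n-1} P_n into the contact plane
    of P_n. That P_n is a vertex is therefore seen from another point of the axis, at height 1, and
    the assumed nondegeneracy then forces the contact set to be this vertex. *)

Lemma vec3E (x y z : R) :
  (vec3 x y z 0 0 = x) * (vec3 x y z 0 1 = y) * (vec3 x y z 0 2 = z).
Proof. by rewrite /vec3 !mxE. Qed.

Lemma vec3_eta p : p = vec3 (p 0 0) (p 0 1) (p 0 2).
Proof.
by apply/rowP => -[[|[|[|//]]] i3]; rewrite /vec3 mxE /=;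
  congr (p _ _); exact: val_inj.
Qed.

Lemma row3P p q : p 0 0 = q 0 0 -> p 0 1 = q 0 1 -> p 0 2 = q 0 2 -> p = q.
Proof. by move=> h0 h1 h2; rewrite [p]vec3_eta [q]vec3_eta h0 h1 h2. Qed.

Lemma rotzE (t : R) p :
  (rotz t p 0 0 = cos t * p 0 0 - sin t * p 0 1) *
  (rotz t p 0 1 = sin t * p 0 0 + cos t * p 0 1) * (rotz t p 0 2 = p 0 2).
Proof. by rewrite /rotz !vec3E. Qed.

End Coordinates.

(** * Measure-preserving maps *)

Definition measure_preserving d (T : measurableType d) (R : realType)
    (mu : set T -> \bar R) (f : T -> T) : Prop :=
  measurable_fun [set: T] f /\
  forall A, measurable A -> mu (f @^-1` A) = mu A.

Lemma measure_preserving_comp d (T : measurableType d) (R : realType)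
    (mu : set T -> \bar R) (f g : T -> T) :
  measure_preserving mu f -> measure_preserving mu g ->
  measure_preserving mu (f \o g).
Proof.
move=> [mf fP] [mg gP]; split; first exact: measurableT_comp.
move=> A mA; rewrite comp_preimage gP ?fP//.
by rewrite -[X in measurable X]setTI; exact: mf.
Qed.

(** Fubini: the section at x of the preimage is the preimage under [t x] of the section, so the
    integrands that define the two product measures agree pointwise. *)
Lemma measure_preserving_skewr d1 d2 (T1 : measurableType d1)
    (T2 : measurableType d2) (R : realType)
    (m1 : {measure set T1 -> \bar R}) (m2 : {measure set T2 -> \bar R})
    (t : T1 -> T2 -> T2) :
  measurable_fun [set: T1 * T2] (fun p => t p.1 p.2) ->
  (forall x, measure_preserving m2 (t x)) ->
  measure_preserving (m1 \x m2)%E (fun p => (p.1, t p.1 p.2)).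
Proof.
move=> mt tm; split; first exact: measurable_fun_pair.
move=> A mA; apply: eq_integral => x _ /=.
by rewrite -((tm x).2 _ (measurable_xsection x mA)) !xsectionE.
Qed.

Lemma measure_preserving_skewl d1 d2 (T1 : measurableType d1)
    (T2 : measurableType d2) (R : realType)
    (m1 : {sigma_finite_measure set T1 -> \bar R})
    (m2 : {sigma_finite_measure set T2 -> \bar R}) (t : T2 -> T1 -> T1) :
  measurable_fun [set: T1 * T2] (fun p => t p.2 p.1) ->
  (forall y, measure_preserving m1 (t y)) ->
  measure_preserving (m1 \x m2)%E (fun p => (t p.2 p.1, p.2)).
Proof.
move=> mt tm.
have mT : measurable_fun [set: T1 * T2] (fun p => (t p.2 p.1, p.2)).
  exact: measurable_fun_pair.
split=> // A mA.
(* The product measure integrates over the first factor last. Here sections at fixed y are needed,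
   so the order of integration is exchanged by uniqueness of the product measure. *)
have swap B : measurable B -> (m1 \x m2)%E B = (m1 \x^ m2)%E B.
  apply: (product_measure_unique (m' := (m1 \x^ m2)%E)) => C D mC mD.
  exact: product_measure2E.
rewrite !swap//; last by rewrite -[X in measurable X]setTI; exact: mT.
apply: eq_integral => y _ /=.
by rewrite -((tm y).2 _ (measurable_ysection y mA)) !ysectionE.
Qed.

(** The [m2]-measure of the section depends on x alone, and replacing x by [t x] is a change of
    variables in the outer integral. *)
Lemma measure_preserving_fst d1 d2 (T1 : measurableType d1)
    (T2 : measurableType d2) (R : realType)
    (m1 : {measure set T1 -> \bar R})
    (m2 : {sigma_finite_measure set T2 -> \bar R}) (t : T1 -> T1) :
  measure_preserving m1 t ->
  measure_preserving (m1 \x m2)%E (fun p => (t p.1, p.2)).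
Proof.
move=> [mt tP]; split.
  by apply: measurable_fun_pair => //; exact: measurableT_comp.
move=> A mA; rewrite /product_measure1.
rewrite (_ : m2 \o xsection _ = (m2 \o xsection A) \o t); last first.
  by apply/funext => x /=; rewrite !xsectionE.
rewrite -[LHS](@ge0_integral_pushforward _ _ _ _ _ t mt m1 setT)//.
  by apply: eq_measure_integral => B mB _; rewrite -[RHS]tP.
exact: measurable_fun_xsection.
Qed.

Lemma Rintegral_measure_preserving d (T : measurableType d) (R : realType)
    (mu : {measure set T -> \bar R}) (f : T -> T) (g : T -> R) (A : set T) :
  measure_preserving mu f -> measurable A -> measurable_fun [set: T] g ->
  mu.-integrable (f @^-1` A) (EFin \o (g \o f)) ->
  \int[mu]_(x in A) g x = \int[mu]_(x in f @^-1` A) g (f x).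
Proof.
move=> [mf fP] mA mg ig; rewrite /Rintegral; congr fine.
rewrite -[RHS](@integral_pushforward _ _ _ _ _ _ mf mu A (EFin \o g))//;
  last exact/measurable_EFinP.
by apply: eq_measure_integral => B mB _; rewrite -[LHS]fP.
Qed.

(** Lebesgue measure is determined by its values on half-open intervals, and a translation moves
    both endpoints by the same amount. *)
Lemma measure_preserving_shift (R : realType) (a : R) :
  measure_preserving (@lebesgue_measure R)
    ((fun x => x + a) : measurableTypeR R -> measurableTypeR R).
Proof.
pose f : measurableTypeR R -> measurableTypeR R := fun x => x + a.
have mf : measurable_fun setT f.
  apply: continuous_measurable_fun => x.
  by apply: cvgD; [exact: cvg_id|exact: cvg_cst].
split=> // A mA; apply/esym.
pose fP := isMeasurableFun.Build _ _ _ _ _ mf.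
pose F : {mfun measurableTypeR R >-> measurableTypeR R} := HB.pack f fP.
apply: (@lebesgue_measure_unique R (pushforward lebesgue_measure F)) => //=.
move=> _ [[b c]] _ <-.
rewrite /pushforward (_ : F @^-1` _ = `](b - a), (c - a)]%classic); last first.
  by apply/seteqP; split => x /=; rewrite !in_itv/= ltrBlDr lerBrDr.
rewrite !lebesgue_measure_itv/= !lte_fin ltrD2r.
by case: ifP => // _; congr (_ %:E); ring.
Qed.

(* A rotation is a product of three shears, which preserve area by Fubini. *)
Lemma rot_shear (R : realFieldType) (c s a x y : R) :
  c ^+ 2 + s ^+ 2 = 1 -> s != 0 -> a = (c - 1) / s ->
  let x1 := x + a * y in
  let y1 := y + s * x1 in
  x1 + a * y1 = c * x - s * y /\ y1 = s * x + c * y.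
Proof.
move=> cs s0 ea x1 y1.
have as1 : a * s = c - 1 by rewrite ea divfK.
have y1E : y1 = s * x + c * y.
  rewrite /y1 /x1 mulrDr mulrA [s * a]mulrC as1; ring.
split => //; apply: (mulIf s0).
rewrite mulrDl y1E mulrAC as1 mulrDl mulrAC as1.
have -> : (c * x - s * y) * s = c * x * s - s ^+ 2 * y by ring.
by rewrite -[s ^+ 2](addKr (c ^+ 2)) cs; ring.
Qed.

(** * Rotations about the axis and the reflection in the plane z = 0 preserve volume *)

Section Rotation.
Context {R : realType}.

Lemma measure_preserving_rot2 (t : R) : sin t != 0 ->
  measure_preserving (@lebesgue_measure R \x @lebesgue_measure R)%E
    (fun p : measurableTypeR R * measurableTypeR R =>
       (cos t * p.1 - sin t * p.2, sin t * p.1 + cos t * p.2)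
       : measurableTypeR R * measurableTypeR R).
Proof.
move=> st.
pose shx (a : R) (p : measurableTypeR R * measurableTypeR R)
  : measurableTypeR R * measurableTypeR R := (p.1 + a * p.2, p.2).
pose shy (a : R) (p : measurableTypeR R * measurableTypeR R)
  : measurableTypeR R * measurableTypeR R := (p.1, p.2 + a * p.1).
have shxP a :
    measure_preserving (@lebesgue_measure R \x @lebesgue_measure R)%E (shx a).
  apply: (measure_preserving_skewl _
    (t := fun y x : measurableTypeR R => x + a * y : measurableTypeR R)).
    apply: measurable_funD => //; exact: measurable_funM.
  by move=> y; exact: measure_preserving_shift.
have shyP a :
    measure_preserving (@lebesgue_measure R \x @lebesgue_measure R)%E (shy a).
  apply: (measure_preserving_skewr _
    (t := fun x y : measurableTypeR R => y + a * x : measurableTypeR R)).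
    apply: measurable_funD => //; exact: measurable_funM.
  by move=> y; exact: measure_preserving_shift.
(* The coefficient (cos t - 1) / sin t is - tan (t / 2). *)
rewrite (_ : (fun p => _) = shx ((cos t - 1) / sin t) \o
                           (shy (sin t) \o shx ((cos t - 1) / sin t))).
  by apply: measure_preserving_comp => //; exact: measure_preserving_comp.
apply/funext => -[x y].
have [ex ey] := rot_shear x y (cos2Dsin2 t) st erefl.
by rewrite /shx /shy /=; congr (_, _); [exact/esym/ex|exact/esym/ey].
Qed.

Lemma measure_preserving_rot3 (t : R) : sin t != 0 ->
  measure_preserving (@leb3 R)
    (fun p => ((cos t * p.1.1 - sin t * p.1.2,
                sin t * p.1.1 + cos t * p.1.2), p.2)).
Proof.
move=> st; have := measure_preserving_rot2 st.
by move/(measure_preserving_fst (@lebesgue_measure R)).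
Qed.

Lemma measure_preserving_refl3 :
  measure_preserving (@leb3 R) (fun p => (p.1, - p.2)).
Proof.
have nP : measure_preserving (@lebesgue_measure R)
    (-%R : _ -> measurableTypeR R).
  by split; [exact: oppr_measurable|exact: lebesgue_measureN].
have := @measure_preserving_skewr _ _ _ _ R
  (@lebesgue_measure R \x @lebesgue_measure R)%E (@lebesgue_measure R)
  (fun _ => (-%R : _ -> measurableTypeR R)).
apply => //.
by apply: (measurableT_comp nP.1).
Qed.

End Rotation.

(** * Convex hulls *)

Section ConvexHull.
Context {R : realType}.
Implicit Types (p q v : 'rV[R]_3) (S C : set 'rV[R]_3).

Definition segment_closed C : Prop :=
  forall p q t, 0 <= t <= 1 -> C p -> C q -> C ((1 - t) *: p + t *: q).

Lemma convex_setE C : @convex_set R 'rV[R]_3 C <-> segment_closed C.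
Proof.
split=> [cC p q t t01 /mem_set Cp /mem_set Cq|cC p q t].
  have /set_mem := cC q p (Itv01 (andP t01).1 (andP t01).2) Cq Cp.
  by rewrite /conv/= addrC.
rewrite !inE => Cp Cq; rewrite /conv/= addrC; apply: cC => //.
by apply/andP.
Qed.

(** The induction principle for hulls: the facts about all points of the polyhedron below come from
    choosing a suitable [C]. *)
Lemma convex_hull_min S C :
  S `<=` C -> segment_closed C -> convex_hull S `<=` C.
Proof. by move=> SC /convex_setE cC; apply: smallest_sub. Qed.

Lemma sub_convex_hull S : S `<=` convex_hull S.
Proof. exact: sub_smallest. Qed.

Lemma convex_hull_closed S : segment_closed (convex_hull S).
Proof.
move=> p q t t01 Sp Sq C [cC SC].
by apply: ((convex_setE C).1 cC) => //; [exact: Sp|exact: Sq].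
Qed.

(** Adding a point v to the list replaces the hull K by the union of all segments from K to v, a
    continuous image of K x [0, 1]. The set {v} is added separately because K may be empty.
    Compactness is needed for closedness, hence for measurability. *)
Lemma compact_convex_hull (s : seq 'rV[R]_3) : compact (convex_hull [set` s]).
Proof.
elim: s => [|v s IH].
  rewrite (_ : convex_hull _ = set0); first exact: compact0.
  apply/seteqP; split => // p; apply: (@convex_hull_min _ set0) => //.
pose f (x : 'rV[R]_3 * R^o) := (1 - x.2) *: x.1 + x.2 *: v.
pose K := convex_hull [set` s].
have -> : convex_hull [set` v :: s] = [set v] `|` f @` (K `*` `[0, 1]%classic).
  apply/seteqP; split.
    apply: convex_hull_min => [p|].
      rewrite /= inE => /orP[/eqP ->|ps]; [by left|right].
      exists (p, 0); last by rewrite /f/= subr0 scale1r scale0r addr0.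
      by split; [exact: sub_convex_hull|rewrite /= in_itv/= lexx ler01].
    have fv q t b : 0 <= t <= 1 -> 0 <= b <= 1 -> K q ->
        (f @` (K `*` `[0, 1]%classic)) ((1 - t) *: v + t *: f (q, b)).
      move=> /andP[t0 t1] /andP[b0 b1] Kq; exists (q, 1 - t * (1 - b)).
        by split => //=; rewrite in_itv/=; apply/andP; split; nra.
      rewrite /f/=; apply/rowP => i; rewrite !mxE; ring.
    move=> p1 p2 t t01 [->|[[q a] [/= Kq]]].
      move=> [->|[[q a] [/= Kq]]].
        by left; rewrite -scalerDl subrK scale1r.
      by rewrite in_itv/= => a01 <-; right; exact: fv.
    rewrite in_itv/= => a01 <- [->|[[q' b] [/= Kq']]].
      right; rewrite addrC -{1}[t](subKr 1); apply: fv => //.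
      by case/andP: t01 => t0 t1; apply/andP; split; lra.
    rewrite in_itv/= => b01 <-.
    case/andP: t01 a01 b01 => t0 t1 /andP[a0 a1] /andP[b0 b1].
    (* [w] is the total weight carried by K, the rest being at v. If it vanishes the point is v;
       otherwise dividing by it gives a convex combination inside K. *)
    set w := (1 - t) * (1 - a) + t * (1 - b).
    have ta0 : 0 <= (1 - t) * (1 - a) by rewrite mulr_ge0// subr_ge0.
    have tb0 : 0 <= t * (1 - b) by rewrite mulr_ge0// subr_ge0.
    have [w0|w0] := eqVneq w 0.
      left; have ta : (1 - t) * (1 - a) = 0 by rewrite /w in w0; lra.
      have tb : t * (1 - b) = 0 by rewrite /w in w0; lra.
      rewrite /f/= !scalerDr !scalerA ta tb !scale0r !add0r -scalerDl.
      by rewrite [X in X *: v](_ : _ = 1) ?scale1r//; lra.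
    have w_gt0 : 0 < w by rewrite lt_neqAle eq_sym w0 addr_ge0.
    right; exists ((1 - t * (1 - b) / w) *: q + (t * (1 - b) / w) *: q', 1 - w).
      split => /=; last by rewrite in_itv/= /w; apply/andP; split; nra.
      apply: convex_hull_closed => //; rewrite divr_ge0 ?(ltW w_gt0)//=.
      by rewrite ler_pdivrMr// mul1r /w lerDr.
    rewrite /f/=; apply/rowP => i; rewrite !mxE /w; field.
    exact: w0.
  move=> p [->|[[q t] /= [Kq t01] <-]].
    by apply: sub_convex_hull; rewrite /= inE eqxx.
  apply: convex_hull_closed => //.
  - apply: (convex_hull_min _ _ Kq); last exact: convex_hull_closed.
    by move=> x xs; apply: sub_convex_hull; rewrite /= inE; apply/orP; right.
  - by apply: sub_convex_hull; rewrite /= inE eqxx.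
apply: compactU; first exact: compact_set1.
apply: continuous_compact; last first.
  by apply: compact_setX => //; exact: segment_compact.
apply: continuous_subspaceT => -[x t].
apply: cvgD; apply: cvgZ => /=.
- by apply: cvgB; [exact: cvg_cst|exact: cvg_snd].
- exact: cvg_fst.
- exact: cvg_snd.
- exact: cvg_cst.
Qed.

End ConvexHull.

(** * Centers of mass *)

Section Integration.
Context {R : realType}.
Implicit Types (S : set 'rV[R]_3).

Local Notation R3 :=
  (measurableTypeR R * measurableTypeR R * measurableTypeR R)%type.

(** Measurability on triples refers to the product sigma-algebra, so the open complement is
    exhibited as a countable union of boxes with rational centers and radii 1 / (m + 1). *)
Lemma measurable_of_triple S :
  closed S -> measurable (of_triple @^-1` S : set R3).
Proof.
move=> cS; rewrite -[of_triple @^-1` S]setCK; apply: measurableC.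
rewrite preimage_setC; have oS : open (~` S) by exact: closed_openC.
pose B (q : rat * rat * rat * nat) : set R3 :=
  (ball (ratr q.1.1.1 : R) q.2.+1%:R^-1
    `*` ball (ratr q.1.1.2 : R) q.2.+1%:R^-1)
   `*` ball (ratr q.1.2 : R) q.2.+1%:R^-1.
pose F q := if `[< B q `<=` of_triple @^-1` (~` S) >] then B q else set0.
rewrite (_ : of_triple @^-1` _ = \bigcup_q F q).
  apply: countable_bigcupT_measurable => // q; rewrite /F; case: ifP => // _.
  by apply: measurableX; [apply: measurableX|]; exact: measurable_ball.
apply/seteqP; split => [[[x y] z] Sp|p [q _]]; last first.
  by rewrite /F; case: asboolP => // BS Bq; exact: BS.
have : nbhs (of_triple ((x, y), z)) (~` S) by exact: open_nbhs_nbhs.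
move=> /nbhs_ballP[e /= e0 eS].
(* Two points of a box of radius below e / 2 are less than e apart, so a box that contains the given
   point stays in its e-ball. *)
have [n ne] : exists n : nat, n.+1%:R^-1 < e / 2 :> R.
  have /cvgrPdist_lt/(_ (e / 2)) := @cvg_harmonic R.
  rewrite divr_gt0// => /(_ isT)[n _ /(_ n (leqnn n))].
  by rewrite /= sub0r normrN ger0_norm//; exists n.
have rn (a : R) : exists q : rat, ball (ratr q : R) n.+1%:R^-1 a.
  have [|q] := @rat_in_itvoo R (a - n.+1%:R^-1) (a + n.+1%:R^-1).
    by rewrite ltrBlDr -addrA ltrDl addr_gt0.
  rewrite in_itv/= => /andP[q1 q2]; exists q.
  by rewrite /ball/= ltr_norml; apply/andP; split;
    move: (n.+1%:R^-1) (ratr q) q1 q2 => c d; lra.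
have [[[q1 xq] [q2 yq]] [q3 zq]] := (rn x, rn y, rn z).
exists (((q1, q2), q3), n) => //; rewrite /F; case: asboolP => // -[].
move=> [[x' y'] z'] [[/= xq' yq'] zq']; apply: eS.
have near (a b : R) (q : rat) : ball (ratr q : R) n.+1%:R^-1 a ->
    ball (ratr q : R) n.+1%:R^-1 b -> ball a e b.
  rewrite /ball/= !ltr_norml.
  move: (n.+1%:R^-1) (ratr q) ne => c d ? /andP[? ?] /andP[? ?].
  by apply/andP; split; lra.
rewrite /of_triple/=; split => // i [[|[|[|//]]] i3]; rewrite /vec3 !mxE/=.
- exact: near xq xq'.
- exact: near yq yq'.
- exact: near zq zq'.
Qed.

Lemma leb3_bounded S : S `<=` [set p | forall i, `|p 0 i| <= 1] -> closed S ->
  (leb3 (of_triple @^-1` S : set R3) < +oo)%E.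
Proof.
move=> S1 cS; pose I := `[(-1), 1]%classic : set (measurableTypeR R).
have mI : measurable I by exact: measurable_itv.
have lI : (lebesgue_measure I < +oo)%E.
  by rewrite lebesgue_measure_itv/= lte_fin; case: ifP => // _; rewrite ltry.
apply: (@le_lt_trans _ _ (leb3 ((I `*` I) `*` I))).
  apply: le_measure; rewrite ?inE.
  - exact: measurable_of_triple.
  - by apply: measurableX => //; exact: measurableX.
  - move=> [[x y] z] /S1 p1; have := (p1 0, p1 1, p1 2).
    rewrite /of_triple !vec3E /= => -[[]].
    by rewrite !ler_norml => x1 y1 z1; split; [split|]; rewrite /I/= in_itv.
have lII : ((@lebesgue_measure R \x @lebesgue_measure R) (I `*` I) < +oo)%E.
  by rewrite product_measure1E// lte_mul_pinfty ?measure_ge0// ge0_fin_numE.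
rewrite [X in (X < _)%E](_ : _ =
    ((@lebesgue_measure R \x @lebesgue_measure R) (I `*` I) *
     lebesgue_measure I)%E).
  by rewrite lte_mul_pinfty ?measure_ge0// ge0_fin_numE ?measure_ge0.
by apply: product_measure1E => //; exact: measurableX.
Qed.

Lemma integrable_bounded S (f : R3 -> R) :
  S `<=` [set p | forall i, `|p 0 i| <= 1] -> closed S ->
  measurable_fun [set: R3] f ->
  (exists M, forall p, S (of_triple p) -> `|f p| <= M) ->
  leb3.-integrable (of_triple @^-1` S : set R3) (EFin \o f).
Proof.
move=> S1 cS mf [M fM]; apply: measurable_bounded_integrable.
- exact: measurable_of_triple.
- exact: leb3_bounded.
- exact: measurable_funTS.
- exists M; split; first exact: num_real.
  by move=> x Mx p Sp; apply: le_trans (ltW Mx); exact: fM.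
Qed.

End Integration.

(** The matrix identity - rotation has determinant (1 - c)^2 + s^2 > 0. This serves both for the
    center of mass and for the centroid of the k-gon. *)
Lemma rot_fixed_eq0 (R : realFieldType) (c s x y : R) :
  s != 0 -> x = c * x - s * y -> y = s * x + c * y -> x = 0 /\ y = 0.
Proof.
move=> s0 xE yE; have N0 : (1 - c) ^+ 2 + s ^+ 2 != 0.
  by rewrite gt_eqF// ltr_wpDl ?sqr_ge0// lt_neqAle sqr_ge0 eq_sym sqrf_eq0 s0.
have ex : (1 - c) * x = - (s * y) by rewrite mulrBl mul1r {1}xE; ring.
have ey : (1 - c) * y = s * x by rewrite mulrBl mul1r {1}yE; ring.
split; apply: (mulfI N0); rewrite mulr0 mulrDl 2!expr2 -!mulrA.
  by rewrite ex -ey; ring.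
by rewrite ey -[s * y]opprK -ex; ring.
Qed.

(** * Symmetry arguments for first moments *)

Section CenterOfMass.
Context {R : realType}.
Implicit Types (S : set 'rV[R]_3).

Local Notation R3 :=
  (measurableTypeR R * measurableTypeR R * measurableTypeR R)%type.

Lemma center_of_massE S (i : 'I_3) : center_of_mass S 0 i =
  (volume S)^-1 * \int[leb3]_(p in of_triple @^-1` S) of_triple p 0 i.
Proof.
rewrite /center_of_mass.
rewrite [LHS]mxE.
by rewrite mxE.
Qed.

Local Notation integrable_on S f :=
  (leb3.-integrable (of_triple @^-1` S : set R3) (EFin \o f)).

Let unit_cube : set 'rV[R]_3 := [set p | forall i, `|p 0 i| <= 1].

Lemma integrable_coord S : S `<=` unit_cube -> closed S ->
  [/\ integrable_on S (fun p : R3 => p.1.1),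
      integrable_on S (fun p : R3 => p.1.2) &
      integrable_on S (fun p : R3 => p.2)].
Proof.
move=> S1 cS; split.
- apply: integrable_bounded => //.
    exact: (measurableT_comp measurable_fst measurable_fst).
  by exists 1 => -[[x y] z] /S1 /(_ 0); rewrite /of_triple !vec3E.
- apply: integrable_bounded => //.
    exact: (measurableT_comp measurable_snd measurable_fst).
  by exists 1 => -[[x y] z] /S1 /(_ 1); rewrite /of_triple !vec3E.
- apply: integrable_bounded => //; first exact: measurable_snd.
  by exists 1 => -[[x y] z] /S1 /(_ 2); rewrite /of_triple !vec3E.
Qed.

(** Substituting the rotation in the two horizontal moments shows that the vector they form is fixed
    by that rotation. *)
Lemma center_of_mass_rotz S (t : R) : S `<=` unit_cube -> closed S ->
  sin t != 0 -> (forall p, S (rotz t p) <-> S p) ->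
  center_of_mass S 0 0 = 0 /\ center_of_mass S 0 1 = 0.
Proof.
move=> S1 cS st St; have [ix iy iz] := integrable_coord S1 cS.
have rP := measure_preserving_rot3 st.
have mS := measurable_of_triple cS.
set f := (fun p : R3 => _) in rP.
have fS : f @^-1` (of_triple @^-1` S) = of_triple @^-1` S.
  apply/seteqP; have fE p : of_triple (f p) = rotz t (of_triple p).
    by rewrite /of_triple /rotz !vec3E.
  by split => p /=; rewrite fE => /St.
have mx : measurable_fun [set: R3] (fun p : R3 => p.1.1).
  exact: (measurableT_comp measurable_fst measurable_fst).
have my : measurable_fun [set: R3] (fun p : R3 => p.1.2).
  exact: (measurableT_comp measurable_snd measurable_fst).
have mix (a : R) : integrable_on S (fun p : R3 => a * p.1.1).
  by apply: eq_integrable (integrableZl mS a ix) => // p _; rewrite /= EFinM.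
have miy (a : R) : integrable_on S (fun p : R3 => a * p.1.2).
  by apply: eq_integrable (integrableZl mS a iy) => // p _; rewrite /= EFinM.
have ifx : integrable_on S ((fun p : R3 => p.1.1) \o f).
  by apply: eq_integrable (integrableB mS (mix (cos t)) (miy (sin t))) => // p _;
    rewrite /= -EFinB.
have ify : integrable_on S ((fun p : R3 => p.1.2) \o f).
  by apply: eq_integrable (integrableD mS (mix (sin t)) (miy (cos t))) => // p _;
    rewrite /= -EFinD.
pose X := \int[leb3]_(p in of_triple @^-1` S) p.1.1.
pose Y := \int[leb3]_(p in of_triple @^-1` S) p.1.2.
have XE : X = cos t * X - sin t * Y.
  rewrite {1}/X (Rintegral_measure_preserving rP mS mx) fS//=.
  by rewrite RintegralB// !RintegralZl.
have YE : Y = sin t * X + cos t * Y.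
  rewrite {1}/Y (Rintegral_measure_preserving rP mS my) fS//=.
  by rewrite RintegralD// !RintegralZl.
have [X0 Y0] : X = 0 /\ Y = 0.
  exact: (rot_fixed_eq0 st XE YE).
rewrite !center_of_massE.
have -> : \int[leb3]_(p in of_triple @^-1` S) of_triple p 0 0 = X.
  by apply: eq_Rintegral => p _; rewrite /of_triple vec3E.
have -> : \int[leb3]_(p in of_triple @^-1` S) of_triple p 0 1 = Y.
  by apply: eq_Rintegral => p _; rewrite /of_triple vec3E.
by rewrite X0 Y0 mulr0.
Qed.

Lemma center_of_mass_ge0 S : S `<=` unit_cube -> closed S ->
  (forall x y z, 0 <= z -> S (vec3 x y (- z)) -> S (vec3 x y z)) ->
  0 <= center_of_mass S 0 2.
Proof.
move=> S1 cS Sz; have [_ _ iz] := integrable_coord S1 cS.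
have mS := measurable_of_triple cS.
have [mr rP] := @measure_preserving_refl3 R.
set f := (fun p : R3 => _) in mr rP.
pose A : set R3 := of_triple @^-1` S; pose A' := f @^-1` A.
have mA' : measurable A' by rewrite -[X in measurable X]setTI; exact: mr.
have iz' : leb3.-integrable A' (EFin \o (fun p : R3 => - p.2)).
  apply: measurable_bounded_integrable => //.
  - by rewrite rP//; exact: leb3_bounded.
  - by apply: measurable_funTS; apply: measurableT_comp => //;
      exact: measurable_snd.
  - exists 1; split; first exact: num_real.
    move=> M M1 [[x y] z] /S1 /(_ 2); rewrite /of_triple vec3E /= => z1.
    by rewrite normrN in z1 *; exact: le_trans z1 (ltW M1).
(* With the convention that 0 has inverse 0, the factor [(volume S)^-1] is nonnegative for every
   value of the volume, so the sign is that of the moment. *)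
rewrite center_of_massE mulr_ge0//; first by rewrite invr_ge0 fine_ge0.
have -> : \int[leb3]_(p in of_triple @^-1` S) of_triple p 0 2 =
    \int[leb3]_(p in A) p.2.
  by apply: eq_Rintegral => p _; rewrite /of_triple vec3E.
(* Twice the moment is the integral over [A] of z plus the integral over its mirror image [A'] of
   -z. On the intersection these cancel; the assumption on [S] forces z >= 0 on [A] minus [A'] and z
   <= 0 on [A'] minus [A]. *)
rewrite -(pmulrn_lge0 _ (ltn0Sn 1)) mulr2n.
rewrite {2}(Rintegral_measure_preserving (conj mr rP) mS measurable_snd iz').
rewrite [X in X + _]Rintegral_mkcond [X in _ + X]Rintegral_mkcond.
rewrite -RintegralD//; last 2 first.
- by rewrite -restrict_EFin; exact: ((integrable_mkcond _ mS).1 iz).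
- by rewrite -restrict_EFin; exact: ((integrable_mkcond _ mA').1 iz').
apply: Rintegral_ge0 => -[[x y] z] _; rewrite /patch.
case: ifPn => [/set_mem pA|pA]; case: ifPn => [/set_mem pA'|pA'] /=.
- by rewrite subrr.
- rewrite addr0 leNgt; apply/negP => z0; move/negP: pA'; apply.
  apply/mem_set/Sz; first by rewrite /= oppr_ge0 ltW.
  by rewrite /= opprK.
- rewrite add0r oppr_ge0 leNgt; apply/negP => z0; move/negP: pA; apply.
  by apply/mem_set/Sz => //; exact: ltW.
- by rewrite addr0.
Qed.

End CenterOfMass.

(** * The planar spiral *)

Section PlanarSpiral.
Context {R : realFieldType} (n : nat) (x z : nat -> R).
Hypothesis x0 : x 0%N = 0.
Hypothesis z0 : z 0%N = 1.
Hypothesis x_gt0 : forall i, (i < n)%N -> 0 < x i.+1.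
Hypothesis z_step : forall i, (i < n)%N -> z i.+1 < z i.
Hypothesis right_angle : forall i, (i < n)%N ->
  x i.+1 * (x i - x i.+1) + z i.+1 * (z i - z i.+1) = 0.

Let sqn i := x i ^+ 2 + z i ^+ 2.

(** By the right angle, P_i - P_{i+1} is a multiple m of (-z_{i+1}, x_{i+1}), the quarter turn of
    P_{i+1}; m is the tangent of the central angle between them. Its sign comes from the decreasing
    heights. *)
Lemma spiral_step i : (i < n)%N ->
  exists m, [/\ 0 < m, x i = x i.+1 - m * z i.+1 & z i = z i.+1 + m * x i.+1].
Proof.
move=> i_n; have x1 := x_gt0 i_n; exists ((z i - z i.+1) / x i.+1); split.
- by rewrite divr_gt0// subr_gt0 z_step.
- apply: (mulfI (lt0r_neq0 x1)); rewrite mulrBr mulrA [_ * (_ / _)]mulrC.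
  by rewrite divfK ?lt0r_neq0//; have := right_angle i_n; lra.
- by rewrite divfK ?lt0r_neq0// addrC subrK.
Qed.

Lemma spiral_x_ge0 i : (i <= n)%N -> 0 <= x i.
Proof. by case: i => [|i] i_n; rewrite ?x0// ltW// x_gt0. Qed.

Lemma spiral_z_antitone i j : (i <= j <= n)%N -> z j <= z i.
Proof.
move=> /andP[ij]; elim: j ij => [|j IH]; first by rewrite leqn0 => /eqP ->.
rewrite leq_eqVlt => /predU1P[-> //|ij] jn.
by apply: le_trans (IH ij (ltnW jn)); exact/ltW/z_step.
Qed.

Lemma spiral_norm_antitone i j : (i <= j <= n)%N -> sqn j <= sqn i.
Proof.
move=> /andP[ij]; elim: j ij => [|j IH]; first by rewrite leqn0 => /eqP ->.
rewrite leq_eqVlt => /predU1P[-> //|ij] jn.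
apply: le_trans (IH ij (ltnW jn)); rewrite /sqn.
by have [m [m0 -> ->]] := spiral_step jn; nra.
Qed.

(** The sign of this cross product orders the rays by their angle from the z-axis. Consecutive rays
    are ordered by [spiral_step]; transitivity follows as for slopes, after multiplication by
    [x j]. *)
Lemma spiral_cross_ge0 i j : (i <= j <= n)%N -> x i * z j <= z i * x j.
Proof.
move=> /andP[ij]; elim: j ij => [|j IH].
  by rewrite leqn0 => /eqP ->; rewrite mulrC.
rewrite leq_eqVlt => /predU1P[->|]; first by rewrite mulrC.
rewrite ltnS => ij jn.
have jS : x j * z j.+1 <= z j * x j.+1.
  have [m [m0 -> ->]] := spiral_step jn; nra.
move: ij; rewrite leq_eqVlt => /predU1P[-> //|ij].
(* The case [i = j] is already settled, so [j] is not 0, where [x] vanishes. *)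
have xj : 0 < x j.
  by case: j ij jn {IH jS} => // j _ jn; apply: x_gt0; exact: ltnW.
have xi : 0 <= x i by apply: spiral_x_ge0; apply: leq_trans (ltnW ij) (ltnW jn).
have x1 := x_gt0 jn; have c := IH (ltnW ij) (ltnW jn).
rewrite -(ler_pM2l xj).
have h1 : x i * (x j * z j.+1) <= x i * (z j * x j.+1) by rewrite ler_wpM2l.
have h2 : x i * z j * x j.+1 <= z i * x j * x j.+1 by rewrite ler_wpM2r// ltW.
by move: h1 h2; rewrite !mulrA => h1 h2; lra.
Qed.

(** As a function of i, the product <P_i, P_m> increases up to i = m and decreases afterwards: by
    [spiral_step] each step changes it by a positive multiple of a cross product whose sign is
    known. Both inductions walk away from m. *)
Lemma spiral_support i m : (i <= n)%N -> (m <= n)%N ->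
  x i * x m + z i * z m <= sqn m.
Proof.
move=> i_n mn; have [im|/ltnW mi] := leqP i m.
  rewrite -(subKn im); elim: (m - i)%N (leq_subr i m) => [|d IH] dm.
    by rewrite subn0 /sqn !expr2.
  apply: le_trans (IH (ltnW dm)).
  have e : (m - d = (m - d.+1).+1)%N by rewrite subnSK.
  have jn : (m - d.+1 < n)%N by rewrite -e (leq_trans (leq_subr _ _)).
  have := @spiral_cross_ge0 (m - d)%N m; rewrite leq_subr mn => /(_ isT).
  rewrite e; have [u [u0 -> ->]] := spiral_step jn; nra.
rewrite -(subnKC mi); have : (m + (i - m) <= n)%N by rewrite subnKC.
elim: (i - m)%N => [|d IH] dn; first by rewrite addn0 /sqn !expr2.
rewrite addnS in dn *; apply: le_trans (IH (ltnW dn)).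
have := @spiral_cross_ge0 m (m + d).+1; rewrite dn -addnS leq_addr => /(_ isT).
rewrite addnS; have [u [u0 -> ->]] := spiral_step dn; nra.
Qed.

Lemma spiral_height s : z n <= s <= z 0%N -> (0 < n)%N ->
  exists i t, [/\ (i < n)%N, 0 <= t <= 1 & (1 - t) * z i + t * z i.+1 = s].
Proof.
move=> /andP[zs s0] n0.
have [i [i_n zi si]] : exists i, [/\ (i < n)%N, z i.+1 <= s & s <= z i].
  elim: n zs n0 => // k IH zs _; have [sk|ks] := leP s (z k); first by exists k.
  case: k IH zs ks => [|k] IH zs ks; first by move: s0; rewrite leNgt ks.
  by have [i [ik ? ?]] := IH (ltW ks) isT; exists i; split => //; exact: ltnW.
have d0 : 0 < z i - z i.+1 by rewrite subr_gt0 z_step.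
exists i, ((z i - s) / (z i - z i.+1)); split => //.
  by rewrite divr_ge0 ?(ltW d0) ?subr_ge0//= ler_pdivrMr// mul1r lerD2l lerN2.
by field; exact: lt0r_neq0.
Qed.

(* Distances to the origin decrease along the profile, so at height [s >= 0] it
   is at least as far from the axis as at height [- s]. *)
Lemma spiral_profile (r s : R) : (0 < n)%N -> 0 <= r -> 0 <= s -> z n <= - s ->
  (forall m, (m <= n)%N -> r * x m + - s * z m <= sqn m) ->
  exists i t, [/\ (i < n)%N, 0 <= t <= 1, (1 - t) * z i + t * z i.+1 = s &
                  r <= (1 - t) * x i + t * x i.+1].
Proof.
move=> n0 r0 s0 zs rs.
(* The profile does reach height s: s <= - z_n <= |P_n| <= |P_0| = 1. *)
have s1 : s <= z 0%N.
  rewrite z0; have : sqn n <= sqn 0.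
    by apply: spiral_norm_antitone; rewrite leqnn.
  rewrite /sqn x0 z0; have := sqr_ge0 (x n) => ? ?.
  rewrite leNgt; apply/negP => ?; nra.
have [|i [t [i_n t01 ts]]] := @spiral_height s _ n0.
  by rewrite s1 andbT; apply: le_trans zs _; lra.
exists i, t; split => //; case/andP: (t01) => t0 t1.
have x1 := x_gt0 i_n; have := rs i.+1 i_n; rewrite /sqn.
set q := (1 - t) * x i + t * x i.+1.
(* The point (q, s) is on the edge P_i P_{i+1}, hence on the line through P_{i+1} perpendicular to O
   P_{i+1}. *)
have qE : q * x i.+1 + s * z i.+1 = sqn i.+1.
  rewrite /q -ts /sqn; have := right_angle i_n; nra.
have [z1 h|z1 _] := leP (z i.+1) 0.
  rewrite -(ler_pM2r x1); rewrite /sqn in qE.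
  have : s * z i.+1 <= 0 by rewrite mulr_ge0_le0.
  lra.
(* Now z_{i+1} > 0, whereas the edge P_j P_{j+1} at height -s ends at or below height 0, so i < j.
   With e the radius on that edge, the chain is |(e, -s)| <= |P_j| <= |P_{i+1}| <= |(q, s)|, an edge
   being farthest from O at its start and nearest at its end. *)
have [|j [u [jn u01 us]]] := @spiral_height (- s) _ n0.
  by rewrite zs/=; lra.
case/andP: u01 => u0 u1.
set e := (1 - u) * x j + u * x j.+1.
have eE : e * x j.+1 + - s * z j.+1 = sqn j.+1.
  rewrite /e -us /sqn; have := right_angle jn; nra.
have re : r <= e.
  by rewrite -(ler_pM2r (x_gt0 jn)); have := rs j.+1 jn; lra.
apply: (le_trans re).
have ij : (i < j)%N.
  rewrite ltnNge; apply/negP => ji.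
  have := @spiral_z_antitone j.+1 i.+1; rewrite ltnS ji i_n => /(_ isT).
  have : z j.+1 <= - s by have := z_step jn; rewrite -us; nra.
  lra.
have nij : sqn j <= sqn i.+1 by apply: spiral_norm_antitone; rewrite ij ltnW.
have ej : e ^+ 2 + s ^+ 2 <= sqn j.
  have [m [m0 xj zj]] := spiral_step jn.
  have -> : s ^+ 2 = ((1 - u) * z j + u * z j.+1) ^+ 2 by rewrite us sqrrN.
  rewrite /sqn /e xj zj; set X := x j.+1; set Z := z j.+1.
  have -> : ((1 - u) * (X - m * Z) + u * X) ^+ 2 +
      ((1 - u) * (Z + m * X) + u * Z) ^+ 2 =
      (X ^+ 2 + Z ^+ 2) * (1 + (1 - u) ^+ 2 * m ^+ 2) by ring.
  have -> : (X - m * Z) ^+ 2 + (Z + m * X) ^+ 2 =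
      (X ^+ 2 + Z ^+ 2) * (1 + m ^+ 2) by ring.
  rewrite ler_wpM2l ?addr_ge0 ?sqr_ge0// lerD2l ler_piMl ?sqr_ge0//.
  by rewrite expr_le1// ?subr_ge0//; lra.
have iq : sqn i.+1 <= q ^+ 2 + s ^+ 2.
  have [m [m0 xi zi]] := spiral_step i_n.
  rewrite -ts /sqn /q xi zi; set X := x i.+1; set Z := z i.+1.
  have -> : ((1 - t) * (X - m * Z) + t * X) ^+ 2 +
      ((1 - t) * (Z + m * X) + t * Z) ^+ 2 =
      (X ^+ 2 + Z ^+ 2) * (1 + ((1 - t) * m) ^+ 2) by ring.
  by rewrite ler_peMr ?addr_ge0 ?sqr_ge0// lerDl sqr_ge0.
have q0 : 0 <= q.
  rewrite /q addr_ge0// mulr_ge0//; [lra| |exact: ltW].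
  by apply: spiral_x_ge0; exact: ltnW.
have e0 : 0 <= e by exact: le_trans r0 re.
rewrite -(@ler_pXn2r _ 2)// ?nnegrE//; lra.
Qed.

End PlanarSpiral.

(** * From angles to scalar products *)

Section EuclideanGeometry.
Context {R : realType}.
Implicit Types (p q u v : 'rV[R]_3).

Lemma dotE u v : dot u v = u 0 0 * v 0 0 + u 0 1 * v 0 1 + u 0 2 * v 0 2.
Proof.
rewrite /dot !big_ord_recl big_ord0 addr0 addrA.
by congr (_ * _ + _ * _ + _ * _); congr (_ _ _); exact: val_inj.
Qed.

Lemma dotBl p q u : dot (p - q) u = dot p u - dot q u.
Proof. by rewrite !dotE !mxE; ring. Qed.

Lemma dot_ge0 u : 0 <= dot u u.
Proof. by rewrite dotE -!expr2 !addr_ge0 ?sqr_ge0. Qed.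

Lemma enorm_sqr u : enorm u ^+ 2 = dot u u.
Proof. by rewrite sqr_sqrtr ?dot_ge0. Qed.

Lemma dot_le_enorm u v : `|dot u v| <= enorm u * enorm v.
Proof.
have nn : 0 <= enorm u * enorm v by rewrite mulr_ge0 ?sqrtr_ge0.
rewrite -(@ler_pXn2r _ 2)// ?nnegrE// real_normK ?num_real// exprMn !enorm_sqr.
rewrite !dotE -subr_ge0.
set a := u 0 0; set b := u 0 1; set c := u 0 2.
set a' := v 0 0; set b' := v 0 1; set c' := v 0 2.
rewrite (_ : _ - _ = (a * b' - b * a') ^+ 2 + (a * c' - c * a') ^+ 2 +
                     (b * c' - c * b') ^+ 2); last by ring.
by rewrite !addr_ge0 ?sqr_ge0.
Qed.

Lemma cosine_itv u v : -1 <= dot u v / (enorm u * enorm v) <= 1.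
Proof.
have nn : 0 <= enorm u * enorm v by rewrite mulr_ge0 ?sqrtr_ge0.
rewrite -ler_norml normrM normfV (ger0_norm nn).
have [->|n0] := eqVneq (enorm u * enorm v) 0.
  by rewrite invr0 mulr0 ler01.
rewrite ler_pdivrMr ?mul1r ?dot_le_enorm//.
by rewrite lt_neqAle eq_sym n0.
Qed.

Lemma angle_eq_pi2 p q v : angle p q v = pi / 2 -> dot (p - q) (v - q) = 0.
Proof.
rewrite /angle => h; have w1 := cosine_itv (p - q) (v - q).
have := acosK; move/(_ R _ w1); rewrite h cos_pihalf => /esym/eqP.
(* The quotient also vanishes by convention when a norm is 0; Cauchy-Schwarz then makes the scalar
   product 0 as well. *)
rewrite mulf_eq0 invr_eq0 => /orP[/eqP //|/eqP n0].
by apply/normr0_eq0/eqP; rewrite eq_le normr_ge0 -n0 dot_le_enorm.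
Qed.

Lemma angle_lt p q v v' : angle p q v < angle p q v' ->
  dot (p - q) (v' - q) / (enorm (p - q) * enorm (v' - q)) <
  dot (p - q) (v - q) / (enorm (p - q) * enorm (v - q)).
Proof.
rewrite /angle; have := cosine_itv (p - q) (v - q).
have := cosine_itv (p - q) (v' - q).
set w := _ / _; set w' := _ / _ => w1' w1 lt.
rewrite -(acosK w1) -(acosK w1') ltr_cos// in_itv/=.
  by rewrite acos_ge0 ?acos_lepi.
by rewrite acos_ge0 ?acos_lepi.
Qed.

End EuclideanGeometry.

(* With [(a, b)] and [(a', b')] on the unit circle,
   [(b a' - a b') (a + a') = (b - b') (1 + a a' + b b')]. *)
Lemma cross_gt0 (R : rcfType) (x z x' z' : R) :
  0 <= x -> 0 < x' -> 0 < x ^+ 2 + z ^+ 2 ->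
  z' / Num.sqrt (x' ^+ 2 + z' ^+ 2) < z / Num.sqrt (x ^+ 2 + z ^+ 2) ->
  x * z' < z * x'.
Proof.
move=> x0 x'0 xz0.
set r' := Num.sqrt (x' ^+ 2 + _); set r := Num.sqrt (x ^+ 2 + _) => lt.
have r'0 : 0 < r' by rewrite sqrtr_gt0 ltr_pwDl ?exprn_gt0 ?sqr_ge0.
have r2 : r ^+ 2 = x ^+ 2 + z ^+ 2 by rewrite sqr_sqrtr ?addr_ge0 ?sqr_ge0.
have r'2 : r' ^+ 2 = x' ^+ 2 + z' ^+ 2 by rewrite sqr_sqrtr ?addr_ge0 ?sqr_ge0.
have r0 : 0 < r by rewrite sqrtr_gt0.
have r_neq0 := lt0r_neq0 r0.
have xE : x = r * (x / r) by rewrite mulrCA divff ?mulr1.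
have zE : z = r * (z / r) by rewrite mulrCA divff ?mulr1.
have x'E : x' = r' * (x' / r') by rewrite mulrCA divff ?mulr1// lt0r_neq0.
have z'E : z' = r' * (z' / r') by rewrite mulrCA divff ?mulr1// lt0r_neq0.
have a0 : 0 <= x / r by rewrite divr_ge0 // ltW.
have a'0 : 0 < x' / r' by rewrite divr_gt0.
have u : (x / r) ^+ 2 + (z / r) ^+ 2 = 1.
  by rewrite !expr_div_n -mulrDl -r2 divff// expf_neq0.
have u' : (x' / r') ^+ 2 + (z' / r') ^+ 2 = 1.
  by rewrite !expr_div_n -mulrDl -r'2 divff// expf_neq0 ?lt0r_neq0.
rewrite xE zE x'E z'E; move: (x / r) (z / r) (x' / r') (z' / r') lt a0 a'0 u u'.
move=> a b a' b' lt a0 a'0 u u'.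
have : 0 < (b * a' - a * b') * (a + a').
  have -> : (b * a' - a * b') * (a + a') = (b - b') * (1 + a * a' + b * b').
    have -> : (b * a' - a * b') * (a + a') =
        (b - b') * (a * a') + b * a' ^+ 2 - b' * a ^+ 2 by ring.
    have -> : a' ^+ 2 = 1 - b' ^+ 2 by rewrite -u' addrK.
    have -> : a ^+ 2 = 1 - b ^+ 2 by rewrite -u addrK.
    by ring.
  rewrite mulr_gt0 ?subr_gt0//.
  have -> : 1 + a * a' + b * b' = ((a + a') ^+ 2 + (b + b') ^+ 2) / 2.
    have -> : (a + a') ^+ 2 + (b + b') ^+ 2 =
        (a ^+ 2 + b ^+ 2) + (a' ^+ 2 + b' ^+ 2) + 2 * (a * a' + b * b') by ring.
    by rewrite u u'; field.
  by rewrite divr_gt0// ltr_pwDl ?sqr_ge0// exprn_gt0// ltr_wpDl.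
rewrite pmulr_lgt0; last by rewrite ltr_wpDl.
rewrite subr_gt0 => h.
have -> : r * a * (r' * b') = r * r' * (a * b') by ring.
have -> : r * b * (r' * a') = r * r' * (b * a') by ring.
by rewrite ltr_pM2l ?mulr_gt0.
Qed.

(** The decrease of heights is the point: by the right angle, |P_{i+1}|^2 (z_i - z_{i+1}) = x_{i+1}
    (z_i x_{i+1} - x_i z_{i+1}), and the last factor is positive because the angle from the z-axis
    increases. *)
Lemma conway_spiral_planar (R : realType) n (P : nat -> 'rV[R]_3) :
  conway_spiral n P ->
  [/\ P 0%N 0 0 = 0, P 0%N 0 2 = 1,
      forall i, (i < n)%N -> 0 < P i.+1 0 0,
      forall i, (i < n)%N -> P i.+1 0 2 < P i 0 2 &
      forall i, (i < n)%N ->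
        P i.+1 0 0 * (P i 0 0 - P i.+1 0 0) +
        P i.+1 0 2 * (P i 0 2 - P i.+1 0 2) = 0].
Proof.
move=> [P0 Py Px Pr Pt]; have x0 : P 0%N 0 0 = 0 by rewrite P0 vec3E.
have z0 : P 0%N 0 2 = 1 by rewrite P0 vec3E.
have x_gt0 i : (i < n)%N -> 0 < P i.+1 0 0 by move=> i_n; exact: Px.
have ra i : (i < n)%N ->
        P i.+1 0 0 * (P i 0 0 - P i.+1 0 0) +
        P i.+1 0 2 * (P i 0 2 - P i.+1 0 2) = 0.
  move=> i_n; have := angle_eq_pi2 (Pr i i_n).
  rewrite dotE !mxE !Py ?(ltnW i_n)//.
  lra.
split => // i i_n.
have x_ge0 : 0 <= P i 0 0.
  by case: i i_n => [|i] i_n; rewrite ?x0// ltW// x_gt0 // ltnW.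
have lt := angle_lt (Pt i i_n).
have cosE j : (j <= n)%N ->
    dot (vec3 0 0 1 - 0) (P j - 0) / (enorm (vec3 0 0 1 - 0) * enorm (P j - 0)) =
    P j 0 2 / Num.sqrt (P j 0 0 ^+ 2 + P j 0 2 ^+ 2).
  move=> jn; rewrite !subr0 /enorm !dotE !vec3E Py//.
  rewrite !(mul0r, add0r, mulr1, mul1r, sqrtr1, mulr0, addr0).
  by rewrite -!expr2.
rewrite !cosE// in lt; last exact: ltnW.
have x1 := x_gt0 i i_n; have r := ra i i_n.
have c : P i 0 0 * P i.+1 0 2 < P i 0 2 * P i.+1 0 0.
  apply: cross_gt0 => //; case: i {lt r x1} i_n x_ge0 => [|i] i_n _.
    by rewrite x0 z0 expr0n/= add0r expr1n.
  by rewrite ltr_pwDl ?sqr_ge0// exprn_gt0// x_gt0// ltnW.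
have N0 : 0 < P i.+1 0 0 ^+ 2 + P i.+1 0 2 ^+ 2.
  by rewrite ltr_pwDl ?sqr_ge0// exprn_gt0.
rewrite -subr_gt0 -(pmulr_rgt0 _ N0).
have -> : (P i.+1 0 0 ^+ 2 + P i.+1 0 2 ^+ 2) * (P i 0 2 - P i.+1 0 2) =
    P i.+1 0 0 * (P i 0 2 * P i.+1 0 0 - P i 0 0 * P i.+1 0 2).
  move: r; set X := P i.+1 0 0; set Z := P i.+1 0 2 => r.
  apply/eqP; rewrite -subr_eq0.
  rewrite (_ : _ - _ = Z * (X * (P i 0 0 - X) + Z * (P i 0 2 - Z))).
    by rewrite r mulr0.
  by ring.
by rewrite mulr_gt0// subr_gt0.
Qed.

(** * The polyhedron *)

Section RotationZ.
Context {R : realType}.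
Implicit Types (p q : 'rV[R]_3) (s t : R).

Lemma rotzD s t p : rotz s (rotz t p) = rotz (s + t) p.
Proof.
by apply: row3P; rewrite !rotzE ?cosD ?sinD; ring.
Qed.

Lemma rotz0 p : rotz 0 p = p.
Proof. by apply: row3P; rewrite !rotzE ?cos0 ?sin0; ring. Qed.

Lemma rotz_2pi t p : rotz (t + 2 * pi) p = rotz t p.
Proof.
have e : 2 * pi = pi *+ 2 :> R by rewrite mulr_natl.
by apply: row3P; rewrite !rotzE ?e ?cosD2pi ?sinD2pi.
Qed.

Lemma rotz_cos1 s p : cos s = 1 -> rotz s p = p.
Proof.
move=> c1; have s0 : sin s = 0 by apply: cos1sin0; rewrite c1 normr1.
by apply: row3P; rewrite rotzE ?c1 ?s0; ring.
Qed.

Lemma rotz_conv s t p q :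
  rotz s ((1 - t) *: p + t *: q) = (1 - t) *: rotz s p + t *: rotz s q.
Proof. by apply: row3P; rewrite !(rotzE, mxE); ring. Qed.

Lemma segment_closed_rotz t (C : set 'rV[R]_3) :
  segment_closed C -> segment_closed (rotz t @^-1` C).
Proof.
by move=> cC p q u u01 Cp Cq; rewrite /preimage/= rotz_conv; exact: cC.
Qed.

Lemma segment_closed_affine (a : R) (b : 'rV[R]_3) (C : set 'rV[R]_3) :
  segment_closed C -> segment_closed [set p | C (a *: p + b)].
Proof.
move=> cC p q u u01 Cp Cq /=.
have -> : a *: ((1 - u) *: p + u *: q) + b =
    (1 - u) *: (a *: p + b) + u *: (a *: q + b).
  by apply/rowP => i; rewrite !mxE; ring.
exact: cC.
Qed.

Lemma segment_closed_le (u : 'rV[R]_3) (a : R) :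
  segment_closed [set p | dot p u <= a].
Proof.
move=> p q t /andP[t0 t1] /= pa qa.
have -> : dot ((1 - t) *: p + t *: q) u = (1 - t) * dot p u + t * dot q u.
  by rewrite !dotE !mxE; ring.
have : (1 - t) * dot p u <= (1 - t) * a by rewrite ler_wpM2l// subr_ge0.
have : t * dot q u <= t * a by rewrite ler_wpM2l.
lra.
Qed.

Lemma segment_closed_average (C : set 'rV[R]_3) m (f : nat -> 'rV[R]_3) :
  segment_closed C -> (forall j, (j <= m)%N -> C (f j)) ->
  C (m.+1%:R^-1 *: \sum_(j < m.+1) f j).
Proof.
move=> cC; elim: m => [|m IH] Cf.
  by rewrite big_ord1 invr1 scale1r; exact: Cf.
rewrite big_ord_recr/=.
have m1 : m.+1%:R != 0 :> R by rewrite pnatr_eq0.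
have m2 : m.+2%:R != 0 :> R by rewrite pnatr_eq0.
have -> : m.+2%:R^-1 *: (\sum_(j < m.+1) f j + f m.+1) =
    (1 - m.+2%:R^-1) *: (m.+1%:R^-1 *: \sum_(j < m.+1) f j) +
    m.+2%:R^-1 *: f m.+1.
  rewrite scalerDr scalerA; congr (_ *: _ + _).
  rewrite -[m.+2%:R]natr1 in m2 *; move: (m.+1%:R) m1 m2 => M m1 m2.
  by field; rewrite ?m1 ?m2.
apply: cC; last exact: Cf.
  by rewrite invr_ge0 ler0n/= invf_le1 ?ltr0n// ler1n.
by apply: IH => j jm; apply: Cf; exact: leqW.
Qed.

Definition kgon_angle k : R := 2 * pi / k%:R.

(** This is where k > 2 enters: the sine of the angle is nonzero, so the rotation fixes no
    horizontal vector but 0. *)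
Lemma kgon_angle_itv k : (2 < k)%N -> 0 < kgon_angle k < pi.
Proof.
move=> k2; have k0 : 0 < k%:R :> R by rewrite ltr0n (ltn_trans _ k2).
rewrite /kgon_angle divr_gt0 ?mulr_gt0 ?pi_gt0//= ltr_pdivrMr//.
by rewrite mulrC ltr_pM2l ?pi_gt0// ltr_nat.
Qed.

Lemma rotz_kgon_period k p : (0 < k)%N -> rotz (k%:R * kgon_angle k) p = p.
Proof.
move=> k0; rewrite /kgon_angle mulrCA divff ?pnatr_eq0 -?lt0n// mulr1.
by rewrite -[2 * pi]add0r rotz_2pi rotz0.
Qed.

Definition kgon k : set 'rV[R]_3 := convex_hull
  [set p | exists2 j, (j < k)%N & p = rotz (j%:R * kgon_angle k) (vec3 1 0 0)].

Lemma kgon_horizontal k p : kgon k p -> p 0 2 = 0.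
Proof.
apply: (@convex_hull_min R _ [set p | p 0 2 = 0]).
  by move=> _ [j _ ->]; rewrite /= rotzE vec3E.
by move=> u v t _ /= u0 v0; rewrite !mxE u0 v0 !mulr0 addr0.
Qed.

(** The centroid of the vertices is fixed by the rotation, hence is 0. Consequently smaller dilates
    of the k-gon lie in larger ones. *)
Lemma kgon0 k : (2 < k)%N -> kgon k 0.
Proof.
case: k => // k k2; have [t0 tpi] := andP (kgon_angle_itv k2).
set t := kgon_angle k.+1 in t0 tpi.
have st : sin t != 0 by rewrite lt0r_neq0// sin_gt0_pi// t0.
pose f j := rotz (j%:R * t) (vec3 1 0 0).
have <- : k.+1%:R^-1 *: \sum_(j < k.+1) f j = 0.
  have fS : \sum_(j < k.+1) f j = \sum_(j < k.+1) f j.+1.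
    rewrite big_ord_recl [RHS]big_ord_recr/= addrC; congr (_ + _).
    by rewrite /f mul0r rotz0 rotz_kgon_period.
  have fSE j : f j.+1 = rotz t (f j).
    by rewrite rotzD -[X in X + _]mul1r -mulrDl addrC natr1.
  have [s0 s1] : (\sum_(j < k.+1) f j) 0 0 = 0 /\ (\sum_(j < k.+1) f j) 0 1 = 0.
    apply: (rot_fixed_eq0 st).
      rewrite {1}fS !summxE !mulr_sumr -sumrB; apply: eq_bigr => j _.
      by rewrite fSE rotzE.
    rewrite {1}fS !summxE !mulr_sumr -big_split; apply: eq_bigr => j _.
    by rewrite fSE rotzE.
  have s2 : (\sum_(j < k.+1) f j) 0 2 = 0.
    by rewrite summxE big1// => j _; rewrite /f rotzE vec3E.
  by apply: row3P; rewrite !mxE ?s0 ?s1 ?s2 mulr0.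
apply: segment_closed_average; first exact: convex_hull_closed.
by move=> j jk; apply: sub_convex_hull; exists j.
Qed.

End RotationZ.

(** * The hull described by a radius, a point of the k-gon and a height *)

Section ConwayPolyhedron.
Context {R : realType} {n k : nat} {P : nat -> 'rV[R]_3}.
Context (n_gt0 : (0 < n)%N) (k_gt2 : (2 < k)%N) (spiralP : conway_spiral n P).

Local Notation x i := (P i 0 0).
Local Notation z i := (P i 0 2).
Local Notation t := (@kgon_angle R k).
Local Notation S := (conway_polyhedron n k P).
Let e3 : 'rV[R]_3 := vec3 0 0 1.
Let e1 : 'rV[R]_3 := vec3 1 0 0.

Let k_gt0 : (0 < k)%N. Proof. exact: ltn_trans k_gt2. Qed.

Let planar := conway_spiral_planar spiralP.
Let x0 : x 0%N = 0. Proof. by case: planar. Qed.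
Let z0 : z 0%N = 1. Proof. by case: planar. Qed.
Let x_gt0 i : (i < n)%N -> 0 < x i.+1.
Proof. by case: planar => _ _ + _ _; exact. Qed.
Let z_step i : (i < n)%N -> z i.+1 < z i.
Proof. by case: planar => _ _ _ + _; exact. Qed.
Let right_angle i : (i < n)%N ->
  x i.+1 * (x i - x i.+1) + z i.+1 * (z i - z i.+1) = 0.
Proof. by case: planar => _ _ _ _; exact. Qed.

Let combE a b (u v : 'rV[R]_3) i :
  (a *: u + b *: v) 0 i = a * u 0 i + b * v 0 i.
Proof. by rewrite !mxE. Qed.

Lemma conway_vertexE s i : (i <= n)%N ->
  rotz s (P i) = x i *: rotz s e1 + z i *: e3.
Proof.
case: spiralP => _ Py _ _ _ i_n; apply: row3P;
  by rewrite combE !rotzE !vec3E ?Py//; ring.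
Qed.

Lemma compact_conway_polyhedron : compact S.
Proof.
pose s := [seq rotz (j%:R * t) (P i) | i <- iota 0 n.+1, j <- iota 0 k].
rewrite /conway_polyhedron (_ : conway_vertices n k P = [set` s]).
  exact: compact_convex_hull.
apply/seteqP; split => p.
  move=> [i [j [i_n jk ->]]]; apply/allpairsP; exists (i, j).
  by rewrite !mem_iota.
move=> /allpairsP[[i j] []]; rewrite !mem_iota => i_n jk ->.
by exists i, j; split.
Qed.

Lemma closed_conway_polyhedron : closed S.
Proof.
exact: compact_closed (@norm_hausdorff _ _) compact_conway_polyhedron.
Qed.

Lemma conway_polyhedron_vertex i j : (i <= n)%N -> (j < k)%N ->
  S (rotz (j%:R * t) (P i)).
Proof. by move=> i_n jk; apply: sub_convex_hull; exists i, j. Qed.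

Lemma conway_polyhedron_unit_cube : S `<=` [set p | forall i, `|p 0 i| <= 1].
Proof.
have rowP (v : 'rV[R]_3) : `|v 0 0| <= 1 -> `|v 0 1| <= 1 -> `|v 0 2| <= 1 ->
    forall i, `|v 0 i| <= 1.
  by move=> v0 v1 v2 [[|[|[|//]]] i3]; [move: v0|move: v1|move: v2];
    congr (`|v _ _| <= 1); exact: val_inj.
apply: convex_hull_min => [_ [i [j [i_n jk ->]]]|].
  have : x i ^+ 2 + z i ^+ 2 <= 1.
    have := @spiral_norm_antitone _ n (fun i => x i) (fun i => z i)
      x_gt0 z_step right_angle 0%N i.
    by rewrite i_n x0 z0 expr0n/= add0r expr1n; apply.
  rewrite conway_vertexE//; move: (x i) (z i) => X Z N1.
  have X1 : `|X| <= 1.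
    rewrite -(@expr_le1 _ 2)// real_normK ?num_real//.
    by apply: le_trans N1; rewrite lerDl sqr_ge0.
  have Z1 : `|Z| <= 1.
    rewrite -(@expr_le1 _ 2)// real_normK ?num_real//.
    by apply: le_trans N1; rewrite lerDr sqr_ge0.
  apply: rowP; rewrite combE ?rotzE !vec3E.
  - by rewrite !mulr0 subr0 addr0 mulr1 normrM mulr_ile1// cos_max.
  - by rewrite !mulr0 !addr0 mulr1 normrM mulr_ile1// sin_max.
  - by rewrite mulr0 add0r mulr1.
move=> p q u /andP[u0 u1] /= p1 q1 i; rewrite !mxE.
rewrite (le_trans (ler_normD _ _))// !normrM (ger0_norm u0).
rewrite ger0_norm ?subr_ge0//.
have := p1 i; have := q1 i => qi pi.
have : (1 - u) * `|p 0 i| <= (1 - u) * 1 by rewrite ler_wpM2l// subr_ge0.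
have : u * `|q 0 i| <= u * 1 by rewrite ler_wpM2l.
lra.
Qed.

Lemma conway_polyhedron_rotz p : S (rotz t p) <-> S p.
Proof.
have rotS q : S q -> S (rotz t q).
  apply: (@convex_hull_min _ _ (rotz t @^-1` S)); last first.
    by apply: segment_closed_rotz; exact: convex_hull_closed.
  move=> _ [i [j [i_n jk ->]]] /=; rewrite -/(kgon_angle k) rotzD.
  rewrite -[X in X + _]mul1r -mulrDl addrC natr1.
  have [jk1|] := ltnP j.+1 k; first exact: conway_polyhedron_vertex.
  move=> kj; have -> : j.+1 = k by apply/eqP; rewrite eqn_leq jk.
  rewrite rotz_kgon_period//.
  by have := conway_polyhedron_vertex i_n k_gt0; rewrite mul0r rotz0.
split; last exact: rotS.
have rotSm m q : S q -> S (rotz (m%:R * t) q).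
  elim: m q => [|m IH] q Sq; first by rewrite mul0r rotz0.
  by rewrite -natr1 mulrDl mul1r -rotzD; apply: IH; exact: rotS.
(* Rotating k - 1 more times completes a full turn, which undoes the first rotation. *)
move=> /(rotSm k.-1); rewrite rotzD -[X in _ + X]mul1r -mulrDl natr1 prednK//.
by rewrite rotz_kgon_period.
Qed.

Lemma conway_polyhedron_level w i : (i <= n)%N -> kgon k w ->
  S (x i *: w + z i *: e3).
Proof.
move=> i_n; apply: (@convex_hull_min _ _ [set w | S (x i *: w + z i *: e3)]).
  move=> _ [j jk ->]; rewrite /= -conway_vertexE//.
  exact: conway_polyhedron_vertex.
by apply: segment_closed_affine; exact: convex_hull_closed.
Qed.

(** The inequalities of [spiral_support] are linear in the pair (radius, height), so they pass from
    the vertices to the whole hull. They bound the radius of a point from its height alone. *)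
Lemma conway_polyhedron_coords :
  S `<=` [set p : 'rV[R]_3 | exists (r : R) (w : 'rV[R]_3),
    [/\ 0 <= r, kgon k w, z n <= p 0 2, p = r *: w + p 0 2 *: e3 &
    forall m, (m <= n)%N -> r * x m + p 0 2 * z m <= x m ^+ 2 + z m ^+ 2]].
Proof.
apply: convex_hull_min => [_ [i [j [i_n jk ->]]]|].
  exists (x i), (rotz (j%:R * t) e1); rewrite !rotzE; split.
  - exact: (@spiral_x_ge0 _ n (fun i => x i)).
  - by apply: sub_convex_hull; exists j.
  - by apply: (@spiral_z_antitone _ n (fun i => z i) z_step); rewrite i_n leqnn.
  - exact: conway_vertexE.
  - move=> m mn.
    exact: (@spiral_support _ n (fun i => x i) (fun i => z i)).
move=> p q u /andP[u0 u1] [r [w [r0 Kw zp pE rp]]] [r' [w' [r'0 Kw' zq qE rq]]].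
have u1' : 0 <= 1 - u by rewrite subr_ge0.
have rr0 : 0 <= (1 - u) * r by rewrite mulr_ge0.
have rr'0 : 0 <= u * r' by rewrite mulr_ge0.
pose s := (1 - u) * r + u * r'.
have s0 : 0 <= s by rewrite addr_ge0.
have pq2 := combE (1 - u) u p q 2.
(* Radii combine linearly, while the points of the k-gon are averaged with weights proportional to
   their share of the radius [s]; for [s = 0] any point will do. *)
have [v [Kv sv]] : exists v, kgon k v /\
    s *: v = ((1 - u) * r) *: w + (u * r') *: w'.
  have [s_eq0|s_neq0] := eqVneq s 0.
    exists w; split => //; rewrite s_eq0 scale0r.
    move/eqP: s_eq0; rewrite paddr_eq0// => /andP[/eqP-> /eqP->].
    by rewrite !scale0r addr0.
  exists ((1 - u * r' / s) *: w + (u * r' / s) *: w'); split.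
    apply: convex_hull_closed => //.
    rewrite divr_ge0//= ler_pdivrMr ?mul1r ?lerDr//.
    by rewrite lt_neqAle eq_sym s_neq0.
  rewrite scalerDr !scalerA mulrBr mulr1 mulrCA divff// mulr1.
  by rewrite /s addrK.
exists s, v; rewrite pq2; split => //.
- have : (1 - u) * z n <= (1 - u) * p 0 2 by rewrite ler_wpM2l.
  have : u * z n <= u * q 0 2 by rewrite ler_wpM2l.
  lra.
- rewrite sv {1}pE {1}qE; apply/rowP => l; rewrite !mxE; ring.
- move=> m mn; rewrite /s.
  have := rp m mn; have := rq m mn; set N := x m ^+ 2 + _ => hq hp.
  have : (1 - u) * (r * x m + p 0 2 * z m) <= (1 - u) * N by rewrite ler_wpM2l.
  have : u * (r' * x m + q 0 2 * z m) <= u * N by rewrite ler_wpM2l.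
  lra.
Qed.

Lemma conway_polyhedron_reflect a b c : 0 <= c ->
  S (vec3 a b (- c)) -> S (vec3 a b c).
Proof.
move=> c0 /conway_polyhedron_coords[r [w [r0 Kw]]]; rewrite !vec3E => zc pE rp.
have [i [u [i_n /andP[u0 u1] ui ri]]] :=
  @spiral_profile _ n (fun i => x i) (fun i => z i) x0 z0 x_gt0 z_step
    right_angle r c n_gt0 r0 c0 zc rp.
set q := (1 - u) * x i + u * x i.+1 in ri.
have w2 := kgon_horizontal Kw.
have aE : a = r * w 0 0.
  by move/rowP/(_ 0): pE; rewrite combE !vec3E; lra.
have bE : b = r * w 0 1.
  by move/rowP/(_ 1): pE; rewrite combE !vec3E; lra.
(* Since r <= q and the k-gon contains 0, w can be shrunk by r / q. The reflected point then lies
   between the two points over the same [v] at the levels of P_i and P_{i+1}. *)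
have [v [Kv qv]] : exists v, kgon k v /\ q *: v = r *: w.
  have [q_eq0|q_neq0] := eqVneq q 0.
    exists w; split => //; rewrite q_eq0; congr (_ *: _); apply/le_anti.
    by rewrite r0 -q_eq0 ri.
  have q0 : 0 < q by rewrite lt_neqAle eq_sym q_neq0 (le_trans r0).
  exists ((1 - r / q) *: 0 + (r / q) *: w); split.
    apply: convex_hull_closed => //; last exact: kgon0.
    by rewrite divr_ge0 ?(ltW q0)//= ler_pdivrMr// mul1r.
  by rewrite scaler0 add0r scalerA mulrCA divff// mulr1.
have -> : vec3 a b c = (1 - u) *: (x i *: v + z i *: e3) +
                       u *: (x i.+1 *: v + z i.+1 *: e3).
  have v2 := kgon_horizontal Kv.
  have qvE l : q * v 0 l = r * w 0 l by move/rowP/(_ l): qv; rewrite !mxE.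
  apply: row3P; rewrite !combE !vec3E ?v2 ?aE ?bE -?qvE -?ui /q; ring.
apply: convex_hull_closed; first by rewrite u0.
  by apply: conway_polyhedron_level => //; exact: ltnW.
exact: conway_polyhedron_level.
Qed.

End ConwayPolyhedron.

(** * Equilibria *)

Section Vertices.
Context {R : realType}.
Implicit Types (p q c u : 'rV[R]_3) (S : set 'rV[R]_3).

Lemma affine_hull_set1 q : affine_hull [set q] = [set q].
Proof.
apply/seteqP; split; last exact: sub_smallest.
apply: smallest_sub => // p p' t /= -> ->.
by rewrite -scalerDl subrK scale1r.
Qed.

Lemma has_dim_set1 q : has_dim [set q] 0.
Proof.
exists q, 0%VS; split; last exact: dimv0.
rewrite affine_hull_set1; apply/seteqP; split => [p ->|_ [v /= + <-]] /=.
  by exists 0; rewrite ?addr0//= mem0v.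
by rewrite memv0 => /eqP ->; rewrite addr0.
Qed.

Lemma relint_set1 q : relint [set q] q.
Proof.
split=> //; rewrite affine_hull_set1 /within/=.
exact: nearW.
Qed.

(** From an interior point one could move a little along both u and -u, which violates either
    one-sided inequality. *)
Lemma supports_bd S q u : supports S q u -> bd S q.
Proof.
move=> [u0 Sq Su]; split; first exact: subset_closure.
move=> /= Sint.
pose f (t : R^o) := q + t *: u.
have cf : {for 0, continuous f}.
  apply: cvgD; first exact: cvg_cst.
  by apply: cvgZ; [exact: cvg_id|exact: cvg_cst].
have f0 : f 0 = q by rewrite /f scale0r addr0.
have uu : 0 < dot u u.
  rewrite lt_neqAle dot_ge0 andbT eq_sym; apply: contraNneq u0 => /eqP.
  rewrite dotE -!expr2 !paddr_eq0 ?addr_ge0 ?sqr_ge0// !sqrf_eq0.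
  move=> /andP[/andP[/eqP h0 /eqP h1] /eqP h2].
  by apply/eqP/row3P; rewrite mxE.
have /nbhs_ballP[e /= e0 eS] : nbhs (0 : R^o) (f @^-1` S).
  by apply: cf; rewrite f0.
have dE t : dot (f t - q) u = t * dot u u.
  by rewrite !dotE !mxE; ring.
have fS t : `|t| < e -> S (f t).
  by move=> te; apply: eS; rewrite /ball/= sub0r normrN.
have e2 : 0 < e / 2 by rewrite divr_gt0.
have ee : e / 2 < e by lra.
case: Su => Su.
  have /Su : S (f (e / 2)) by apply: fS; rewrite gtr0_norm.
  by rewrite dE leNgt mulr_gt0.
have /Su : S (f (- (e / 2))) by apply: fS; rewrite normrN gtr0_norm.
by rewrite dE mulNr oppr_ge0 leNgt mulr_gt0.
Qed.

(** Nondegeneracy makes the contact set the only face with q in its relative interior. The singleton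
    {q} is such a face, exposed by a direction u that may differ from q - c, so the two coincide. *)
Lemma equilibrium_vertex_unstable S c q u : supports S q u ->
  plane q u `&` S = [set q] -> equilibrium S c q -> Defs.nondegenerate S c q ->
  unstable S c q.
Proof.
move=> Su uq eq nd; split => //; have [_ /(_ [set q])->] := nd.
  exact: has_dim_set1.
split; last exact: relint_set1.
exists 0%N => //; split; last exact: has_dim_set1.
by exists q, u; rewrite uq.
Qed.

End Vertices.

(** * The copies of the last vertex *)

Section ConwayEquilibria.
Context {R : realType} {n k : nat} {P : nat -> 'rV[R]_3}.
Context (n_gt0 : (0 < n)%N) (k_gt2 : (2 < k)%N) (spiralP : conway_spiral n P).

Local Notation x i := (P i 0 0).
Local Notation z i := (P i 0 2).
Local Notation t := (@kgon_angle R k).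
Local Notation S := (conway_polyhedron n k P).
Local Notation Q j := (rotz (j%:R * t) (P n)).

Let xn_gt0 : 0 < x n.
Proof.
by case: n n_gt0 (conway_spiral_planar spiralP) => // m _ [_ _ + _ _]; apply.
Qed.

Let zn_lt i : (i < n)%N -> z n < z i.
Proof.
move=> i_n; have [_ _ _ z_step _] := conway_spiral_planar spiralP.
apply: le_lt_trans (z_step _ i_n).
by apply: (@spiral_z_antitone _ n (fun i => z i) z_step); rewrite i_n leqnn.
Qed.

Let x_ge0 i : (i <= n)%N -> 0 <= x i.
Proof.
have [x0 _ x_gt0 _ _] := conway_spiral_planar spiralP.
exact: (@spiral_x_ge0 _ n (fun i => x i)).
Qed.

Lemma dot_conway_vertex h i j s : (i <= n)%N ->
  dot (rotz s (P i) - Q j) (Q j - vec3 0 0 h) =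
  x i * x n * cos (s - j%:R * t) - x n ^+ 2 + (z i - z n) * (z n - h).
Proof.
move=> i_n; have [_ Py _ _ _] := spiralP.
have subE (u v : 'rV[R]_3) l : (u - v) 0 l = u 0 l - v 0 l by rewrite !mxE.
rewrite dotE !subE !rotzE !vec3E !Py// cosB; set a := j%:R * t.
have <- : x n ^+ 2 * (cos a ^+ 2 + sin a ^+ 2) = x n ^+ 2.
  by rewrite cos2Dsin2 mulr1.
by ring.
Qed.

(** Writing the cosine as 1 plus (cos - 1) isolates the planar inequality [spiral_support] at m = n.
    Of the two terms left, one penalizes turning away from the copy [Q j], the other height above
    P_n. *)
Lemma dot_conway_vertex_le h i j s : (i <= n)%N ->
  dot (rotz s (P i) - Q j) (Q j - vec3 0 0 h) <=
  x i * x n * (cos (s - j%:R * t) - 1) - h * (z i - z n).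
Proof.
move=> i_n; rewrite dot_conway_vertex//.
have [x0 z0 x_gt0 z_step ra] := conway_spiral_planar spiralP.
have := @spiral_support _ n (fun i => x i) (fun i => z i) x0 x_gt0 z_step ra
  i n i_n (leqnn n).
lra.
Qed.

Lemma conway_supports h j : 0 <= h -> (j < k)%N ->
  supports S (Q j) (Q j - vec3 0 0 h).
Proof.
move=> h0 jk; have QS : S (Q j) by exact: conway_polyhedron_vertex.
split => //; last first.
  left; pose u := Q j - vec3 0 0 h.
  have : S `<=` [set p | dot p u <= dot (Q j) u]; last first.
    by move=> SQ p /SQ /=; rewrite dotBl subr_le0.
  apply: convex_hull_min; last exact: segment_closed_le.
  move=> _ [i [l [i_n lk ->]]] /=; rewrite -subr_le0 -dotBl.
  apply: le_trans (dot_conway_vertex_le h j _ i_n) _.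
  rewrite subr_le0 (@le_trans _ _ 0)//.
    by rewrite mulr_ge0_le0 ?subr_le0 ?cos_le1// mulr_ge0 ?(ltW xn_gt0)// x_ge0.
  rewrite mulr_ge0// subr_ge0; case: ltngtP i_n => // [/zn_lt/ltW|->] //.
(* The direction is nonzero because [Q j] is off the axis. *)
rewrite subr_eq0; apply/eqP => QE; move: k_gt2.
have : x n * cos (j%:R * t) = 0 /\ x n * sin (j%:R * t) = 0.
  have [_ Py _ _ _] := spiralP.
  have := congr1 (fun p : 'rV[R]_3 => (p 0 0, p 0 1)) QE.
  by rewrite !rotzE !vec3E Py// => -[] *; split; lra.
move=> [/eqP]; rewrite mulf_eq0 (gt_eqF xn_gt0)/= => /eqP c0 /eqP.
rewrite mulf_eq0 (gt_eqF xn_gt0)/= => /eqP s0.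
have := cos2Dsin2 (j%:R * t); rewrite c0 s0 expr0n/= addr0 => /esym/eqP.
by rewrite oner_eq0.
Qed.

(** At height 1 the term - h (z_i - z_n) is strictly negative for i < n, and for i = n the cosine is
    below 1 unless the copies coincide. A point together with an open half-space bounded by a plane
    through it is convex, so strictness extends to the hull. *)
Lemma conway_vertex_exposed j : (j < k)%N ->
  plane (Q j) (Q j - vec3 0 0 1) `&` S = [set Q j].
Proof.
move=> jk; pose u := Q j - vec3 0 0 1.
apply/seteqP; split => [p [pQ Sp]|_ ->]; last first.
  split; last exact: conway_polyhedron_vertex.
  by rewrite /plane/= dotBl subrr.
have : S `<=` [set p | p = Q j \/ dot (p - Q j) u < 0]; last first.
  by move=> /(_ p Sp)[//|]; rewrite /plane/= in pQ; rewrite pQ ltxx.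
apply: convex_hull_min => [_ [i [l [i_n lk ->]]]|].
  have ds := dot_conway_vertex_le 1 j (l%:R * t) i_n.
  have cos1 : cos (l%:R * t - j%:R * t) - 1 <= 0 by rewrite subr_le0 cos_le1.
  have xx0 : 0 <= x i * x n by rewrite mulr_ge0 ?(ltW xn_gt0)// x_ge0.
  have [i_lt_n|] := ltnP i n.
    right; apply: le_lt_trans ds _; have := zn_lt i_lt_n.
    have := mulr_ge0_le0 xx0 cos1; lra.
  move=> ni; have -> : i = n by apply/eqP; rewrite eqn_leq i_n.
  have [c1|c1] := eqVneq (cos (l%:R * t - j%:R * t)) 1.
    by left; rewrite -[in LHS](subrK (j%:R * t) (l%:R * t)) -rotzD rotz_cos1.
  right; rewrite dot_conway_vertex// subrr mul0r addr0 -expr2.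
  rewrite -[X in _ - X]mulr1 -mulrBr.
  by rewrite nmulr_llt0 ?exprn_gt0// subr_lt0 lt_neqAle c1 cos_le1.
move=> p1 p2 s /andP[s0 s1] h1 h2.
have convE : dot ((1 - s) *: p1 + s *: p2 - Q j) u =
    (1 - s) * dot (p1 - Q j) u + s * dot (p2 - Q j) u.
  by rewrite !dotE !mxE; ring.
have dQ : dot (Q j - Q j) u = 0 by rewrite dotBl subrr.
have [s_eq0|s_neq0] := eqVneq s 0.
  by rewrite s_eq0 subr0 scale1r scale0r addr0.
have [s_eq1|s_neq1] := eqVneq s 1.
  by rewrite s_eq1 subrr scale0r scale1r add0r.
have s_gt0 : 0 < s by rewrite lt_neqAle eq_sym s_neq0.
have s_lt1 : 0 < 1 - s by rewrite subr_gt0 lt_neqAle s_neq1.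
case: h1 h2 => [p1Q|h1] [p2Q|h2].
- by left; rewrite p1Q p2Q -scalerDl subrK scale1r.
- by right; rewrite /= convE p1Q dQ mulr0 add0r pmulr_rlt0.
- by right; rewrite /= convE p2Q dQ mulr0 addr0 pmulr_rlt0.
- by right; rewrite /= convE -(addr0 0) ltrD ?pmulr_rlt0.
Qed.

End ConwayEquilibria.

Theorem corollary1 (R : realType) (n k : nat) (P : nat -> 'rV[R]_3) :
  (0 < n)%N -> (2 < k)%N -> conway_spiral n P ->
  ~ mono_monostatic (conway_polyhedron n k P)
      (center_of_mass (conway_polyhedron n k P)).
Proof.
move=> n_gt0 k_gt2 spiralP [nd _ [q [_ q_uniq]]].
set S := conway_polyhedron n k P in nd q_uniq *.
set c := center_of_mass S in nd q_uniq *.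
have cS : closed S by exact: closed_conway_polyhedron.
have S1 := conway_polyhedron_unit_cube spiralP (k := k).
have /andP[t0 tpi] := @kgon_angle_itv R k k_gt2.
have st : sin (kgon_angle k : R) != 0 by rewrite lt0r_neq0// sin_gt0_pi// t0.
have [c0 c1] := center_of_mass_rotz S1 cS st (conway_polyhedron_rotz k_gt2).
have c2 : 0 <= c 0 2.
  apply: center_of_mass_ge0 => // a b d.
  exact: conway_polyhedron_reflect.
have cE : c = vec3 0 0 (c 0 2) by apply: row3P; rewrite !vec3E.
have unstableQ j : (j < k)%N -> unstable S c (rotz (j%:R * kgon_angle k) (P n)).
  move=> jk; have Sc := conway_supports n_gt0 k_gt2 spiralP c2 jk.
  rewrite -cE in Sc.
  (* Support seen from c gives the equilibrium; support seen from height 1 gives the vertex. *)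
  have S1' := conway_supports n_gt0 k_gt2 spiralP ler01 jk.
  have eqQ : equilibrium S c (rotz (j%:R * kgon_angle k) (P n)).
    by split => //; exact: supports_bd Sc.
  apply: equilibrium_vertex_unstable S1' _ eqQ (nd _ eqQ).
  exact: conway_vertex_exposed.
have k0 : (0 < k)%N by exact: ltn_trans k_gt2.
have k1 : (1 < k)%N by exact: ltn_trans k_gt2.
(* If the copies 0 and 1 coincided, their first coordinates would give cosine 1, hence sine 0, for
   the angle 2 pi / k. *)
have := q_uniq _ (unstableQ 1%N k1).
rewrite (q_uniq _ (unstableQ 0%N k0)) mul0r rotz0 mul1r.
move=> /(congr1 (fun p : 'rV[R]_3 => p 0 0)); rewrite rotzE.
have [_ Py Px _ _] := spiralP.
rewrite Py// mulr0 subr0 => /eqP; rewrite -[X in X == _]mul1r.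
have xn : 0 < P n 0 0 by apply: Px; rewrite n_gt0 leqnn.
rewrite (inj_eq (mulIf (lt0r_neq0 xn))) eq_sym => /eqP cos1.
by move: st; rewrite -sqrf_eq0 sin2cos2 cos1 expr1n subrr eqxx.
Qed.
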